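(* Let $\Phi\in\mathcal{E}(I)$. Then $$\mathcal{H}_\Phi(I)\subseteq\mathcal{A}_\Phi(I)\qquad\text{and}\qquad \mathcal{A}_\Phi(I)=\mathcal{C}_\Phi(I)\cap(-\mathcal{C}_\Phi(I)),$$ where $-\mathcal{C}_\Phi(I)=\{-f : f\in\mathcal{C}_\Phi(I)\}$.
   Context: $I\subseteq\mathbb{R}$ is a nonempty open interval and $\ell(I)\in(0,\infty]$ is its length. $\mathcal{E}(I)$ is the set of all functions $\Phi:[0,\ell(I))\to[0,\infty)$ (called error functions). Let $\Phi\in\mathcal{E}(I)$ and $f:I\to\mathbb{R}$. (1) $f$ is $\Phi$-H\''older if $|f(x)-f(y)|\leq\Phi(|x-y|)$ for all $x,y\in I$; the class of such functions is $\mathcal{H}_\Phi(I)$. (2) $f$ is $\Phi$-convex if for all $x,y\in I$, $t\in[0,1]$, $$f(tx+(1-t)y)\leq tf(x)+(1-t)f(y)+t\Phi((1-t)|x-y|)+(1-t)\Phi(t|x-y|);$$ the class of such functions is $\mathcal{C}_\Phi(I)$. (3) $f$ is $\Phi$-affine if for all $x,y\in I$, $t\in[0,1]$, $$|f(tx+(1-t)y)-tf(x)-(1-t)f(y)|\leq t\Phi((1-t)|x-y|)+(1-t)\Phi(t|x-y|);$$ the class of such functions is $\mathcal{A}_\Phi(I)$. *)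

(* Defs.v *)
From HB Require Import structures.
From mathcomp Require Import all_boot all_order all_algebra.
From mathcomp Require Import all_classical all_reals all_analysis.
Set Implicit Arguments.
Unset Strict Implicit.
Unset Printing Implicit Defensive.
Import Order.TTheory GRing.Theory Num.Theory.
Import numFieldNormedType.Exports.
Local Open Scope classical_set_scope.
Local Open Scope ring_scope.

(* Functions I -> R and [0, ell I) -> [0, +oo) are represented by total
   functions R -> R. Only their values at points of I, resp. of [0, ell I),
   are constrained or used below. For x, y in I we have |x - y| < ell I, and
   t * x + (1 - t) * y is in I when 0 <= t <= 1, so no evaluation falls
   outside these domains. *)

(* Valued in \bar R, so that ell I = +oo for unbounded I; in particular
   (+oo) - (-oo) = +oo when I is the whole line. *)
Definition ell (R : realType) (I : set R) : \bar R :=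
  (ereal_sup [set x%:E | x in I] - ereal_inf [set x%:E | x in I])%E.

Definition error_functions (R : realType) (I : set R) : set (R -> R) :=
  [set Phi | forall u : R, 0 <= u -> (u%:E < ell I)%E -> 0 <= Phi u].

Definition holder_class (R : realType) (Phi : R -> R) (I : set R) :
    set (R -> R) :=
  [set f | forall x y : R, I x -> I y -> `|f x - f y| <= Phi `|x - y|].

Definition convex_class (R : realType) (Phi : R -> R) (I : set R) :
    set (R -> R) :=
  [set f | forall x y t : R, I x -> I y -> 0 <= t <= 1 ->
     f (t * x + (1 - t) * y) <=
       t * f x + (1 - t) * f y
       + t * Phi ((1 - t) * `|x - y|) + (1 - t) * Phi (t * `|x - y|)].

Definition affine_class (R : realType) (Phi : R -> R) (I : set R) :
    set (R -> R) :=
  [set f | forall x y t : R, I x -> I y -> 0 <= t <= 1 ->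
     `|f (t * x + (1 - t) * y) - t * f x - (1 - t) * f y| <=
       t * Phi ((1 - t) * `|x - y|) + (1 - t) * Phi (t * `|x - y|)].

(* Main.v *)
Require Import Defs.
From HB Require Import structures.
From mathcomp Require Import all_boot all_order all_algebra.
From mathcomp Require Import all_classical all_reals all_analysis.
From mathcomp Require Import ring lra.
Set Implicit Arguments.
Unset Strict Implicit.
Unset Printing Implicit Defensive.
Import Order.TTheory GRing.Theory Num.Theory.
Import numFieldNormedType.Exports.
Local Open Scope classical_set_scope.
Local Open Scope ring_scope.

(** Write z = t x + (1 - t) y. Since the weights t and 1 - t add up to 1,
    the deviation of f from affinity is an average of increments of f:
      f z - t f x - (1 - t) f y = t (f z - f x) + (1 - t) (f z - f y).
    The point z lies at distance (1 - t) |x - y| from x and t |x - y| from y,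
    so bounding both increments by the Hoelder condition produces exactly the
    error term of Phi-affinity ([holder_sub_affine]).

    Phi-affinity bounds the absolute value of this deviation. The upper bound
    is the Phi-convexity of f, and the lower bound is the Phi-convexity of - f,
    because replacing f by - f changes the sign of the deviation and leaves the
    error term as it is ([affine_classP]). *)

Lemma is_interval_conv (R : realType) (I : set R) (x y t : R) :
  is_interval I -> I x -> I y -> 0 <= t <= 1 -> I (t * x + (1 - t) * y).
Proof.
move=> I_itv Ix Iy /andP[t0 t1]; have [xy|/ltW yx] := leP x y.
- by apply: (I_itv x y) => //; apply/andP; split; nra.
- by apply: (I_itv y x) => //; apply/andP; split; nra.
Qed.

Lemma conv_distl (R : realType) (x y t : R) : t <= 1 ->
  `|t * x + (1 - t) * y - x| = (1 - t) * `|x - y|.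
Proof.
move=> t1; have -> : t * x + (1 - t) * y - x = (1 - t) * (y - x) by ring.
by rewrite normrM ger0_norm ?subr_ge0// distrC.
Qed.

Lemma conv_distr (R : realType) (x y t : R) : 0 <= t ->
  `|t * x + (1 - t) * y - y| = t * `|x - y|.
Proof.
move=> t0; have -> : t * x + (1 - t) * y - y = t * (x - y) by ring.
by rewrite normrM ger0_norm.
Qed.

(** Convexity of I is what makes the Hoelder condition applicable at the
    intermediate point. *)
Lemma holder_sub_affine (R : realType) (I : set R) (Phi : R -> R) :
  is_interval I -> holder_class Phi I `<=` affine_class Phi I.
Proof.
move=> I_itv f fH x y t Ix Iy t01; have /andP[t0 t1] := t01.
have Iz := is_interval_conv I_itv Ix Iy t01.
rewrite -(conv_distl x y t1) -(conv_distr x y t0).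
set z := t * x + (1 - t) * y in Iz *.
have -> : f z - t * f x - (1 - t) * f y
  = t * (f z - f x) + (1 - t) * (f z - f y) by ring.
have s0 : 0 <= 1 - t by rewrite subr_ge0.
apply: (le_trans (ler_normD _ _)); rewrite !normrM (ger0_norm t0) (ger0_norm s0).
by apply: lerD; apply: ler_wpM2l => //; exact: fH.
Qed.

Lemma affine_classP (R : realType) (I : set R) (Phi f : R -> R) :
  affine_class Phi I f <-> convex_class Phi I f /\ convex_class Phi I (\- f).
Proof.
split=> [fA|[fC NfC] x y t Ix Iy t01].
  split=> x y t Ix Iy t01;
    by have := fA x y t Ix Iy t01; rewrite ler_norml => /andP[] /=; lra.
have := fC x y t Ix Iy t01; have := NfC x y t Ix Iy t01 => /= lo up.
by rewrite ler_norml; apply/andP; split; lra.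
Qed.

Theorem proposition2p3 (R : realType) (I : set R)
    (I_nonempty : I !=set0) (I_open : open I) (I_itv : is_interval I)
    (Phi : R -> R) (hPhi : error_functions I Phi) :
  (holder_class Phi I `<=` affine_class Phi I) /\
  (affine_class Phi I =
     convex_class Phi I `&` [set \- f | f in convex_class Phi I]).
Proof.
have oppfK (g : R -> R) : \- (\- g) = g by apply/funext => x /=; rewrite opprK.
split; first exact: holder_sub_affine.
apply/seteqP; split=> [f /affine_classP[fC NfC]|f [fC [g gC gf]]].
  by split=> //; exists (\- f).
by apply/affine_classP; split=> //; rewrite -gf oppfK.
Qed.
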